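(* Let $H$ be a complex Hilbert space, let $(\alpha_1,\dots,\alpha_n)$ be an $n$-tuple of linearly independent vectors in $H$, and let $\gamma\in H$. Let $D(\gamma)=\inf\{\|\gamma-\beta\|:\beta\in\operatorname{span}\{\alpha_1,\dots,\alpha_n\}\}$. Then $$D(\gamma)=\sqrt{\frac{\det\big(\mathrm{Gram}(\gamma,\alpha_1,\dots,\alpha_n)\big)}{\det\big(\mathrm{Gram}(\alpha_1,\dots,\alpha_n)\big)}}.$$
   Context: For vectors $\xi_1,\dots,\xi_m\in H$, $\mathrm{Gram}(\xi_1,\dots,\xi_m)\in M_m(\mathbb C)$ denotes the $m\times m$ matrix with $(i,j)$ entry $\langle\xi_i,\xi_j\rangle$. *)

(* Defs.v *)
From HB Require Import structures.
From mathcomp Require Import all_boot all_order all_algebra.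
From mathcomp Require Import sesquilinear complex.
From mathcomp Require Import all_classical all_reals all_analysis.

Set Implicit Arguments.
Unset Strict Implicit.
Unset Printing Implicit Defensive.

Import Order.TTheory GRing.Theory Num.Theory.

Local Open Scope classical_set_scope.
Local Open Scope complex_scope.
Local Open Scope ring_scope.

(* A Hilbert space over C = R[i] is a complete normed module H together with a
   positive definite hermitian form (linear on the left, conjugate-linear on
   the right) that induces its norm. *)
Definition induces_norm (R : realType) (H : completeNormedModType R[i])
    (ip : {dot H for Num.conj}) : Prop :=
  forall x : H, `|x| = sqrtC (ip x x).

(* H may be infinite-dimensional, hence is not a vectType, so that [free] and
   [span] of vector.v do not apply. *)
Definition lin_indep (K : fieldType) (V : lmodType K) (n : nat)
    (a : n.-tuple V) : Prop :=
  forall c : 'I_n -> K, \sum_(i < n) c i *: tnth a i = 0 -> forall i, c i = 0.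

Definition lin_span (K : fieldType) (V : lmodType K) (n : nat)
    (a : n.-tuple V) : set V :=
  [set v | exists c : 'I_n -> K, v = \sum_(i < n) c i *: tnth a i].

Definition Gram (R : realType) (H : completeNormedModType R[i])
    (ip : {dot H for Num.conj}) (m : nat) (xi : m.-tuple H) : 'M[R[i]]_m :=
  \matrix_(i < m, j < m) ip (tnth xi i) (tnth xi j).

(* The norm of H takes its (real) values in R[i]; [complex.Re] brings them back
   to R, where infima are available. *)
Definition dist_to_span (R : realType) (H : completeNormedModType R[i])
    (n : nat) (a : n.-tuple H) (g : H) : R :=
  inf [set complex.Re `|g - b| | b in lin_span a].

(* Main.v *)
Require Import Defs.
From HB Require Import structures.
From mathcomp Require Import all_boot all_order all_algebra.
From mathcomp Require Import sesquilinear complex.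
From mathcomp Require Import all_classical all_reals all_analysis.

Import Order.TTheory GRing.Theory Num.Theory.

Local Open Scope complex_scope.
Local Open Scope ring_scope.

(** Independence makes the Gram matrix of [alpha] invertible, so its normal
    equations have a solution [c], and [r = gamma - \sum_i c i *: alpha i] is
    orthogonal to the span.  By Pythagoras the distance is attained and equals
    [`|r|].  Subtracting from the row of [gamma] the combination [c] of the
    other rows leaves [(<r, gamma>, 0, ..., 0)], and [<r, gamma> = <r, r>];
    hence [det Gram(gamma, alpha) = |r|^2 * det Gram(alpha)]. *)

Section GramDeterminant.
Variables (R : realType) (H : completeNormedModType R[i]).
Variables (ip : {dot H for Num.conj}) (n : nat) (alpha : n.-tuple H).

Lemma dot_comb_l (c : 'I_n -> R[i]) (y : H) :
  ip (\sum_i c i *: tnth alpha i) y = \sum_i c i * ip (tnth alpha i) y.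
Proof.
by rewrite linear_sumlz; apply: eq_bigr => i _; rewrite linearZl_LR.
Qed.

Lemma dot_comb_r (c : 'I_n -> R[i]) (x : H) :
  (forall j, ip x (tnth alpha j) = 0) ->
  ip x (\sum_i c i *: tnth alpha i) = 0.
Proof.
move=> x_orth; rewrite linear_sumr big1 // => i _.
by rewrite linearZr_LR /= x_orth mulr0.
Qed.

(** Since [ip] is linear on the left, coefficients act as row vectors from the left; this turns
    matrix equations into orthogonality relations. *)
Lemma mul_row_Gram (v : 'rV[R[i]]_n) (j : 'I_n) :
  (v *m Gram ip alpha) 0 j =
    ip (\sum_i v 0 i *: tnth alpha i) (tnth alpha j).
Proof. by rewrite mxE dot_comb_l; apply: eq_bigr => i _; rewrite mxE. Qed.

(** If [v] is in the left kernel, its combination is orthogonal to every vector of [alpha], hence to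
    itself, so it vanishes. *)
Lemma Gram_unitmx : lin_indep alpha -> Gram ip alpha \in unitmx.
Proof.
move=> alpha_indep; rewrite -row_free_unit; apply: inj_row_free => v vG0.
have /eqP : ip (\sum_i v 0 i *: tnth alpha i)
               (\sum_i v 0 i *: tnth alpha i) = 0.
  by apply: dot_comb_r => j; rewrite -mul_row_Gram vG0 mxE.
rewrite dnorm_eq0 => /eqP /alpha_indep v0.
by apply/rowP => i; rewrite mxE v0.
Qed.

Lemma orth_proj_span (gamma : H) : lin_indep alpha ->
  exists c : 'rV[R[i]]_n, forall j,
    ip (gamma - \sum_i c 0 i *: tnth alpha i) (tnth alpha j) = 0.
Proof.
move=> /Gram_unitmx G_unit.
pose b : 'rV[R[i]]_n := \row_j ip gamma (tnth alpha j).
exists (b *m invmx (Gram ip alpha)) => j.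
by rewrite linearBl /= -mul_row_Gram mulmxKV // mxE subrr.
Qed.

Lemma det_Gram_cons (gamma : H) (c : 'rV[R[i]]_n)
    (r := gamma - \sum_i c 0 i *: tnth alpha i) :
  (forall j, ip r (tnth alpha j) = 0) ->
  \det (Gram ip [tuple of gamma :: alpha]) = ip r r * \det (Gram ip alpha).
Proof.
move=> r_orth.
(* The size [1 + n], convertible to [n.+1], lets the row and column of [gamma] be split off as
   blocks. *)
pose M : 'M[R[i]]_(1 + n) := Gram ip [tuple of gamma :: alpha].
pose L : 'M[R[i]]_(1 + n) := block_mx 1%:M (- c) 0 1%:M.
have M_block : M = block_mx (ip gamma gamma)%:M
    (\row_j ip gamma (tnth alpha j)) (\col_i ip (tnth alpha i) gamma)
    (Gram ip alpha).
  apply/matrixP => i j; rewrite -(fintype.splitK i) -(fintype.splitK j).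
  case: (fintype.split i) => i'; case: (fintype.split j) => j' /=;
    rewrite ?block_mxEul ?block_mxEur ?block_mxEdl ?block_mxEdr !mxE;
    rewrite ?(ord1 i') ?(ord1 j') ?eqxx ?mulr1n ?lshift0 ?rshift1 ?tnth0 ?tnthS //.
have ip_rg : ip r r = ip r gamma.
  by rewrite {2}/r linearBr /= dot_comb_r // subr0.
have LM : L *m M =
    block_mx (ip r r)%:M 0 (\col_i ip (tnth alpha i) gamma) (Gram ip alpha).
  rewrite M_block mulmx_block !mul1mx !mul0mx !add0r !mulNmx; congr block_mx.
    apply/matrixP => i j; rewrite !ord1 ip_rg /r linearBl /= dot_comb_l !mxE.
    by rewrite eqxx !mulr1n; congr (_ - _); apply: eq_bigr => k _; rewrite !mxE.
  (* The top right block has entries [ip r (tnth alpha j)], which vanish. *)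
  apply/rowP => j; have := r_orth j.
  by rewrite linearBl /= -mul_row_Gram !mxE.
have detL : \det L = 1 by rewrite det_ublock !det1 mulr1.
by rewrite -[LHS]mul1r -detL -[\det L * _]det_mulmx LM det_lblock det_scalar1.
Qed.

Lemma dist_to_span_orth (gamma : H) (c : 'rV[R[i]]_n)
    (r := gamma - \sum_i c 0 i *: tnth alpha i) :
  induces_norm ip -> (forall j, ip r (tnth alpha j) = 0) ->
  dist_to_span alpha gamma = complex.Re `|r|.
Proof.
move=> ip_norm r_orth.
rewrite /dist_to_span; set E := (X in inf X).
have Er : E (complex.Re `|r|).
  by exists (\sum_i c 0 i *: tnth alpha i) => //; exists (c 0).
have lbE : lbound E (complex.Re `|r|).
  move=> _ [_ [d ->] <-]; rewrite -lecR !RRe_real ?normr_real //.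
  (* Any difference from [gamma] to the span is [r] plus a vector of the span, so Pythagoras
     ([hnormDd]) applies once the norms are squared. *)
  have -> : gamma - \sum_i d i *: tnth alpha i =
      r + \sum_i (c 0 i - d i) *: tnth alpha i.
    under [in RHS]eq_bigr do rewrite scalerBl.
    by rewrite sumrB addrA subrK.
  rewrite !ip_norm ler_sqrtC ?nnegrE ?dnorm_ge0 //.
  have cd_orth := dot_comb_r (fun i => c 0 i - d i) r r_orth.
  by rewrite (hnormDd cd_orth) lerDl dnorm_ge0.
apply/eqP; rewrite eq_le lb_le_inf ?andbT //; last by exists (complex.Re `|r|).
by apply: ge_inf => //; exists (complex.Re `|r|).
Qed.

End GramDeterminant.

Theorem theorem4p1 (R : realType) (H : completeNormedModType R[i])
    (ip : {dot H for Num.conj}) (ip_norm : induces_norm ip)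
    (n : nat) (alpha : n.-tuple H) (alpha_indep : lin_indep alpha)
    (gamma : H) :
  (dist_to_span alpha gamma)%:C =
    sqrtC (\det (Gram ip [tuple of gamma :: alpha]) / \det (Gram ip alpha)).
Proof.
have [c r_orth] := orth_proj_span R H ip n alpha gamma alpha_indep.
rewrite (dist_to_span_orth R H ip n alpha gamma c) //.
rewrite (det_Gram_cons R H ip n alpha gamma c) //.
(* Independence makes the denominator nonzero, so the quotient is [ip r r]. *)
rewrite mulfK; last by rewrite -unitfE -unitmxE Gram_unitmx.
by rewrite RRe_real ?normr_real // ip_norm.
Qed.
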